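(* Let $\Delta$ be any Hadamard simplex of dimension $d$ and let $m,n$ be positive odd integers with $n<m<dn$. If $m>\frac{d-1}{2}n$, then $P_{m,n}=m\Delta\cap[-n,n]^d$ is normal (with respect to $\Lambda_n=(n+2\mathbb Z)^d$). In particular, whenever such a $P_{m,n}$ (with $\Delta$ any Hadamard simplex of dimension $d$ and $m,n$ positive odd, $n<m<dn$) is smooth in $\Lambda_n$, it is normal.
   Context: Hadamard simplices: let $H$ be a real Hadamard matrix of order $N$ (an $N\times N$ matrix with entries $\pm1$ and $HH^{\mathsf T}=NI$). Mark one column of $H$, multiply rows by signs so that this column becomes all ones, and delete it. With $d=N-1$, the remaining rows $v_0,\dots,v_{N-1}\in\{\pm1\}^d$ satisfy $v_i\cdot v_j=N\delta_{ij}-1$ and $\sum_i v_i=0$. The Hadamard simplex is $\Delta=\operatorname{conv}\{v_0,\dots,v_{N-1}\}\subset\mathbb R^d$; equivalently $\Delta=\{x: v_i\cdot x\ge -1\ \forall i\}$. The integer chart $x\mapsto y=(x+n\mathbf 1)/2$ ($\mathbf 1$ the all-ones vector) maps $\Lambda_n$ onto $\mathbb Z^d$ and $P_{m,n}$ onto $$Q_{m,n}=\{y\in[0,n]^d: v_i\cdot y\ge b_i\ \forall i\},\qquad b_i=\tfrac12\Bigl(n\sum_j (v_i)_j-m\Bigr).$$ Normal: for every integer $k\ge1$, every $Z\in kQ_{m,n}\cap\mathbb Z^d$ is a sum of $k$ points of $Q_{m,n}\cap\mathbb Z^d$. (Equivalently, every point of $kP_{m,n}\cap(kn+2\mathbb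 Z)^d$ is a sum of $k$ points of $P_{m,n}\cap\Lambda_n$.) Smooth in $\Lambda_n$: all vertices of $P_{m,n}$ lie in $\Lambda_n$ and, at each vertex of $Q_{m,n}$, the primitive integer normal vectors of all the facets of $Q_{m,n}$ containing that vertex form a basis of the dual lattice, identified with $\mathbb Z^d$. *)

(* Defs.v *)
From mathcomp Require Import all_boot all_order all_algebra.
From mathcomp Require Import boolp classical_sets reals.

Set Implicit Arguments.
Unset Strict Implicit.
Unset Printing Implicit Defensive.

Import Order.TTheory GRing.Theory Num.Theory.
Local Open Scope classical_set_scope.
Local Open Scope ring_scope.

Definition dot (R : realType) (d : nat) (a x : 'rV[R]_d) : R :=
  \sum_j a 0 j * x 0 j.

Definition dilate (R : realType) (d : nat) (t : R) (A : set 'rV[R]_d) :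
  set 'rV[R]_d := [set t *: x | x in A].

Definition convex_hull (R : realType) (d r : nat) (v : 'I_r -> 'rV[R]_d) :
  set 'rV[R]_d :=
  [set x | exists w : 'I_r -> R,
    [/\ forall i, 0 <= w i, \sum_i w i = 1 & x = \sum_i w i *: v i]].

Definition hadamard_matrix (R : realType) (N : nat) (H : 'M[R]_N) : Prop :=
  (forall i j, H i j = 1 \/ H i j = -1) /\ H *m H^T = N%:R%:M.

(* Row [i] of [H] is multiplied by the sign [H i c], which turns the marked
   column [c] into the all-ones column; that column is then deleted. *)
Definition hadamard_vertex (R : realType) (d : nat) (H : 'M[R]_d.+1)
  (c : 'I_d.+1) (i : 'I_d.+1) : 'rV[R]_d :=
  \row_j (H i c * H i (lift c j)).

Definition hadamard_simplex (R : realType) (d : nat) (D : set 'rV[R]_d) :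
  Prop :=
  exists (H : 'M[R]_d.+1) (c : 'I_d.+1),
    hadamard_matrix H /\ D = convex_hull (hadamard_vertex H c).

Definition cube (R : realType) (d n : nat) : set 'rV[R]_d :=
  [set x | forall j, - n%:R <= x 0 j <= n%:R].
Arguments cube : clear implicits.

Definition polytopeP (R : realType) (d : nat) (D : set 'rV[R]_d) (m n : nat) :
  set 'rV[R]_d := dilate m%:R D `&` cube R d n.

(* Lambda_n = (n + 2Z)^d, a translate of the lattice (2Z)^d. *)
Definition Lambda (R : realType) (d n : nat) : set 'rV[R]_d :=
  [set x | forall j, exists z : int, x 0 j = n%:R + 2 * z%:~R].
Arguments Lambda : clear implicits.

Definition int_chart (R : realType) (d n : nat) (x : 'rV[R]_d) : 'rV[R]_d :=
  2^-1 *: (x + const_mx n%:R).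

Definition polytopeQ (R : realType) (d : nat) (D : set 'rV[R]_d) (m n : nat) :
  set 'rV[R]_d := int_chart n @` polytopeP D m n.

Definition int_points (R : realType) (d : nat) : set 'rV[R]_d :=
  [set x | forall j, x 0 j \is a Num.int].
Arguments int_points : clear implicits.

Definition lattice_normal (R : realType) (d : nat) (Q : set 'rV[R]_d) : Prop :=
  forall k : nat, (0 < k)%N ->
  forall Z : 'rV[R]_d, (dilate k%:R Q `&` int_points R d) Z ->
  exists y : 'I_k -> 'rV[R]_d,
    (forall i, (Q `&` int_points R d) (y i)) /\ Z = \sum_i y i.

Definition supports (R : realType) (d : nat) (A : set 'rV[R]_d)
  (a : 'rV[R]_d) (c : R) (F : set 'rV[R]_d) : Prop :=
  (forall x, A x -> c <= dot a x) /\ F = [set x | A x /\ dot a x = c].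

Definition is_face (R : realType) (d : nat) (A F : set 'rV[R]_d) : Prop :=
  exists (a : 'rV[R]_d) (c : R), supports A a c F.

Definition is_vertex (R : realType) (d : nat) (A : set 'rV[R]_d)
  (x : 'rV[R]_d) : Prop := is_face A [set x].

(* The affine hull of [A] is [x0 + U], where [U] is the least linear subspace
   containing [A - x0]. No [k] works for the empty set. *)
Definition affine_dim (R : realType) (d : nat) (A : set 'rV[R]_d) (k : nat) :
  Prop :=
  exists (x0 : 'rV[R]_d) (U : {vspace 'rV[R]_d}),
    [/\ A x0,
        forall x, A x -> x - x0 \in U,
        forall W : {vspace 'rV[R]_d},
          (forall x, A x -> x - x0 \in W) -> (U <= W)%VS
      & \dim U = k].

Definition is_facet (R : realType) (d : nat) (A F : set 'rV[R]_d) : Prop :=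
  is_face A F /\ exists k, affine_dim A k.+1 /\ affine_dim F k.

Definition primitive_vec (d : nat) (u : 'rV[int]_d) : Prop :=
  \big[gcdn/0%N]_j absz (u 0 j) = 1%N.

(* The normal is the inner one: [u] is minimal on the facet. Taking outer
   normals would only change all signs. *)
Definition primitive_facet_normal (R : realType) (d : nat) (A F : set 'rV[R]_d)
  (u : 'rV[int]_d) : Prop :=
  primitive_vec u /\ exists c : R, supports A (map_mx intr u) c F.

(* The rows of [B] form a basis of the free Z-module Z^d. *)
Definition lattice_basis (r d : nat) (B : 'M[int]_(r, d)) : Prop :=
  forall w : 'rV[int]_d, exists! c : 'rV[int]_r, w = c *m B.

Definition normals_at (R : realType) (d : nat) (A : set 'rV[R]_d)
  (y : 'rV[R]_d) : set 'rV[int]_d :=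
  [set u | exists F, [/\ is_facet A F, F y & primitive_facet_normal A F u]].

Definition lattice_smooth (R : realType) (d : nat) (D : set 'rV[R]_d)
  (m n : nat) : Prop :=
  (forall x, is_vertex (polytopeP D m n) x -> Lambda R d n x) /\
  (forall y, is_vertex (polytopeQ D m n) y ->
     exists (r : nat) (B : 'M[int]_(r, d)),
       lattice_basis B /\
       normals_at (polytopeQ D m n) y = [set row i B | i in [set: 'I_r]]).

(* Main.v *)
Require Import Defs.
From mathcomp Require Import all_boot all_order all_algebra.
From mathcomp Require Import boolp classical_sets reals.
From mathcomp Require Import zify ring lra.
Import Order.TTheory GRing.Theory Num.Theory.
Local Open Scope classical_set_scope.
Local Open Scope ring_scope.
Set Implicit Arguments.
Unset Strict Implicit.

(** Write [slack v b i y] for [v_i . y - b_i].  For [n], [m] odd and [d] odd the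
    [b_i] are integers, so slacks of lattice points are integers.

    Normality above the threshold.  Two rows [v_i], [v_i'] agree in exactly
    [(d - 1) / 2] coordinates, so [m > (d - 1) n / 2] says that the sum of two
    different slacks is positive, hence at least 1, on the integer points of
    the whole cube ([threshold_slack_pair]): the simplex cuts disjoint corners
    off the cube.  Given [Z] in [k Q], first write [Z] as a sum of [k] integer
    points of the cube only ([box_decomposition]).  If [y1] violates the i-th
    inequality then, the total slack being nonnegative, some [y2] has positive
    i-th slack, and moving one unit along a well chosen coordinate from [y2] to
    [y1] strictly lowers the total violation ([exchange]).  When no violation
    is left ([repair]) all summands lie in [Q].

    Smoothness forces the threshold.  If [m <= (d - 1) n / 2], the point
    [- m / (d - 1) (v_i + v_i')] belongs to [P] and to the facets of both
    [v_i] and [v_i']; hence the polytope has a vertex on both facets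
    ([vertex_on_two_rows]).  The primitive normals there include [v_i] and
    [v_i'], which are congruent modulo 2, whereas distinct members of a lattice
    basis never are ([basis_rows_mod2]).  So no such polytope is smooth
    ([smooth_threshold]). *)

(** * Exchange of unit vectors between lattice points of a box *)

Section Exchange.
Variables (I : finType) (d : nat) (v : I -> 'rV[int]_d) (b : I -> int) (n : int).

Definition slack (i : I) (y : 'rV[int]_d) : int := \sum_j v i 0 j * y 0 j - b i.
Definition in_box (y : 'rV[int]_d) := forall j, 0 <= y 0 j <= n.
Definition violation (y : 'rV[int]_d) : nat := (\sum_i `|Num.min (0 : int) (slack i y)|)%N.

Lemma slackD i y z : slack i (y + z) = slack i y + \sum_j v i 0 j * z 0 j.
Proof.
by rewrite /slack addrAC -big_split; congr (_ - _); apply: eq_bigr => j _; rewrite mxE mulrDr.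
Qed.

Lemma slack_unit i y (e : int) (j : 'I_d) :
  slack i (y + e *: delta_mx 0 j) = slack i y + v i 0 j * e.
Proof.
rewrite slackD (bigD1 j) //= big1 => [|l lj]; rewrite !mxE !eqxx ?(negbTE lj) /=; lia.
Qed.

Lemma slack_sum i (k : nat) (y : 'I_k -> 'rV[int]_d) :
  \sum_l slack i (y l) = \sum_j v i 0 j * (\sum_l y l) 0 j - k%:Z * b i.
Proof.
rewrite sumrB exchange_big /= sumr_const card_ord -mulr_natl natz; congr (_ - _).
by apply: eq_bigr => j _; rewrite summxE mulr_sumr.
Qed.

Hypothesis v_sign : forall i j, v i 0 j = 1 \/ v i 0 j = -1.
Hypothesis slack_pair : forall i i' y, i != i' -> in_box y -> 0 < slack i y + slack i' y.

(** Some coordinate in [D] contributes positively to the sum; there the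
    coordinates of [y1] and [y2] differ in the direction of [v i 0 j], so the
    move brings them closer and cannot leave the box. *)
Lemma unit_move i (y1 y2 : 'rV[int]_d) (D : pred 'I_d) :
  in_box y1 -> in_box y2 ->
  0 < \sum_(j | D j) v i 0 j * (y2 0 j - y1 0 j) ->
  exists2 j, D j & in_box (y1 + v i 0 j *: delta_mx 0 j) /\
                   in_box (y2 + (- v i 0 j) *: delta_mx 0 j).
Proof.
move=> box1 box2 gt0.
have [j Dj pos_j] : exists2 j, D j & 0 < v i 0 j * (y2 0 j - y1 0 j).
  apply: contrapT => none; move: gt0; rewrite ltNge => /negP; apply.
  apply: sumr_le0 => j Dj; rewrite leNgt; apply/negP => ?; apply: none; exists j => //.
exists j => //; split=> l; rewrite !mxE eqxx /=; move: (box1 l) (box2 l);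
  have [->|_] := eqVneq l j; case: (v_sign i j) pos_j => ->; lia.
Qed.

(** One unit goes from [y2] to [y1] along a coordinate with
    [v i 0 j * (y2 - y1) 0 j > 0].  The other slacks of [y1] are at least 2, so
    they survive.  In [y2], by the pair condition, at most one other slack,
    say the i'-th, is nonpositive; it does not drop provided that the coordinate
    is one where [v i] and [v i'] differ, and such a coordinate exists because
    the sum of [v i 0 j * (y2 - y1) 0 j] over these is half the difference
    of the i-th and the i'-th slack increments from [y1] to [y2], of which the
    first is positive and the second negative. *)
Lemma exchange i (y1 y2 : 'rV[int]_d) :
  in_box y1 -> in_box y2 -> slack i y1 < 0 -> 0 < slack i y2 ->
  exists y1' y2', [/\ in_box y1', in_box y2', y1' + y2' = y1 + y2 &
    (violation y1' + violation y2' < violation y1 + violation y2)%N].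
Proof.
move=> box1 box2 neg1 pos2.
have slackB l : slack l y2 - slack l y1 = \sum_j v l 0 j * (y2 0 j - y1 0 j).
  rewrite /slack opprD addrACA subrr addr0 -sumrB.
  by apply: eq_bigr => j _; rewrite mulrBr.
have [j tightj [b1 b2]] : exists2 j, (forall l, l != i -> slack l y2 <= 0 -> v l 0 j != v i 0 j) &
    in_box (y1 + v i 0 j *: delta_mx 0 j) /\ in_box (y2 + (- v i 0 j) *: delta_mx 0 j).
  have [[i' i'i tight_i']|none] := pselect (exists2 i', i' != i & slack i' y2 <= 0).
    have [|j Dj mv] := @unit_move i y1 y2 (fun j => v i' 0 j != v i 0 j) box1 box2.
      have: \sum_j v i 0 j * (y2 0 j - y1 0 j) - \sum_j v i' 0 j * (y2 0 j - y1 0 j) =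
            2 * \sum_(j | v i' 0 j != v i 0 j) v i 0 j * (y2 0 j - y1 0 j).
        rewrite -sumrB mulr_sumr [RHS]big_mkcond; apply: eq_bigr => j _.
        by case: (v_sign i j) (v_sign i' j) => -> [] ->; rewrite //=; lia.
      rewrite -!slackB.
      have i'i2 : i != i' by rewrite eq_sym.
      have := slack_pair i'i2 box1; lia.
    exists j => // l li tight_l.
    suff -> : l = i' by [].
    apply/eqP; apply: contraT => li'.
    by have := slack_pair li' box2; lia.
  have [|j _ mv] := @unit_move i y1 y2 predT box1 box2; first by rewrite -slackB; lia.
  by exists j => // l li tight_l; case: none; exists l.
exists (y1 + v i 0 j *: delta_mx 0 j), (y2 + (- v i 0 j) *: delta_mx 0 j); split => //.
  by rewrite scaleNr addrACA subrr addr0.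
rewrite -addSn; apply: leq_add.
  rewrite /violation (bigD1 i) // [X in (_ <= X)%N](bigD1 i) //= -addSn; apply: leq_add.
    by rewrite slack_unit; case: (v_sign i j) => ->; lia.
  apply: leq_sum => l li; rewrite slack_unit.
  by have := slack_pair li box1; case: (v_sign i j) (v_sign l j) => -> [] ->; lia.
apply: leq_sum => l _; rewrite slack_unit.
have [->|li] := eqVneq l i; first by case: (v_sign i j) => ->; lia.
have := tightj l li.
by case: (v_sign i j) (v_sign l j) => -> [] -> tl; lia.
Qed.

(** Induction on the total violation: as long as one summand violates an
    inequality, another one has slack to spare in it and they exchange. *)
Lemma repair (k : nat) (y : 'I_k -> 'rV[int]_d) :
  (forall l, in_box (y l)) -> (forall i, 0 <= \sum_l slack i (y l)) ->
  exists y' : 'I_k -> 'rV[int]_d,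
    [/\ forall l, in_box (y' l), forall l i, 0 <= slack i (y' l) &
        \sum_l y' l = \sum_l y l].
Proof.
have [w] := ubnP (\sum_l violation (y l))%N.
elim: w y => // w IHw y le_w box tot.
have [ok|] := pselect (forall l i, 0 <= slack i (y l)); first by exists y.
move=> /existsNP[l1] /existsNP[i] /negP; rewrite -ltNge => neg.
have [l2 pos] : exists l2, 0 < slack i (y l2).
  apply: contrapT => /forallNP none; move: (tot i).
  rewrite (bigD1 l1) //= leNgt => /negP; apply.
  rewrite -[ltRHS]addr0; apply: ltr_leD => //.
  apply: sumr_le0 => l _; rewrite leNgt; apply/negP/none.
have l21 : l2 != l1 by apply/eqP => e; move: pos neg; rewrite e; lia.
have [y1 [y2 [b1 b2 eqS ltV]]] := exchange (box l1) (box l2) neg pos.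
pose y' l := if l == l1 then y1 else if l == l2 then y2 else y l.
have y'1 : y' l1 = y1 by rewrite /y' eqxx.
have y'2 : y' l2 = y2 by rewrite /y' eqxx (negbTE l21).
have y'o l : (l != l1) && (l != l2) -> y' l = y l by rewrite /y' => /andP[/negbTE -> /negbTE ->].
have sum' : \sum_l y' l = \sum_l y l.
  rewrite (bigD1 l1) // (bigD1 l2) //= [RHS](bigD1 l1) // [X in _ = _ + X](bigD1 l2) //=.
  by rewrite y'1 y'2 !addrA eqS; congr (_ + _); apply: eq_bigr.
have [|||y'' [? ? sum'']] := IHw y'; last by exists y''; rewrite sum'' sum'.
- move: le_w; rewrite (bigD1 l1) // (bigD1 l2) //= ltnS => le_w.
  rewrite (bigD1 l1) // (bigD1 l2) //= y'1 y'2.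
  rewrite (eq_bigr (fun l => violation (y l))) => [|l /y'o -> //]; lia.
- by move=> l; rewrite /y'; do 2 case: ifP => _ //.
- move=> i'.
  suff -> : \sum_l slack i' (y' l) = \sum_l slack i' (y l) by [].
  by rewrite !slack_sum sum'.
Qed.
End Exchange.
(** * Vertices and facets of polyhedra *)

Section Dot.
Variables (R : realType) (d : nat).
Implicit Types a x y u : 'rV[R]_d.

Lemma dotE a x : dot a x = (x *m a^T) 0 0.
Proof. by rewrite mxE; apply: eq_bigr => j _; rewrite mxE mulrC. Qed.

Lemma dotC a x : dot a x = dot x a.
Proof. by apply: eq_bigr => j _; rewrite mulrC. Qed.

Lemma dotDr a x y : dot a (x + y) = dot a x + dot a y.
Proof. by rewrite !dotE mulmxDl mxE. Qed.

Lemma dotZr a (t : R) x : dot a (t *: x) = t * dot a x.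
Proof. by rewrite !dotE -scalemxAl mxE. Qed.

Lemma dotBr a x y : dot a (x - y) = dot a x - dot a y.
Proof. by rewrite dotDr -scaleN1r dotZr mulN1r. Qed.

Lemma dot_sumr (I : finType) a (F : I -> 'rV[R]_d) : dot a (\sum_i F i) = \sum_i dot a (F i).
Proof. by rewrite dotE mulmx_suml summxE; apply: eq_bigr => i _; rewrite dotE. Qed.

Lemma dot_suml (I : finType) (F : I -> 'rV[R]_d) x : dot (\sum_i F i) x = \sum_i dot (F i) x.
Proof. by rewrite dotC dot_sumr; apply: eq_bigr => i _; rewrite dotC. Qed.

Lemma dot_self_gt0 a : a != 0 -> 0 < dot a a.
Proof.
move=> a0; rewrite lt_def sumr_ge0 ?andbT => [|j _]; last exact: sqr_ge0.
apply: contra a0 => /eqP /psumr_eq0P sq0; apply/eqP/rowP => j.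
have /eqP := sq0 (fun j _ => sqr_ge0 (a 0 j)) j isT.
by rewrite mulf_eq0 orbb mxE => /eqP.
Qed.
End Dot.

Section Polyhedron.
Variables (R : realType) (d : nat) (T : finType) (g : T -> 'rV[R]_d) (c : T -> R).

Definition polyhedron : set 'rV[R]_d := [set x | forall t, c t <= dot (g t) x].
Definition tight x : {set T} := [set t | dot (g t) x == c t].

(** The sum of the normals of the walls through [x] is minimal exactly where all
    these walls are met, that is, at [x] alone. *)
Lemma vertex_of_tight x :
  polyhedron x ->
  (forall u, (forall t, t \in tight x -> dot (g t) u = 0) -> u = 0) ->
  is_vertex polyhedron x.
Proof.
move=> Px uniq.
exists (\sum_(t | t \in tight x) g t), (\sum_(t | t \in tight x) c t).
have dotS y : dot (\sum_(t | t \in tight x) g t) y = \sum_(t | t \in tight x) dot (g t) y.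
  rewrite big_mkcond dot_suml [RHS]big_mkcond; apply: eq_bigr => t _.
  by case: ifP => // _; rewrite dotC -(scale0r (0 : 'rV[R]_d)) dotZr mul0r.
split=> [y Py|]; first by rewrite dotS; apply: ler_sum.
apply/seteqP; split=> [_ ->|y [Py eqS]] /=.
  by split=> //; rewrite dotS; apply: eq_bigr => t; rewrite inE => /eqP.
apply/eqP; rewrite -subr_eq0; apply/eqP/uniq => t tx.
have /psumr_eq0P z : \sum_(t | t \in tight x) (dot (g t) y - c t) = 0.
  by rewrite sumrB -dotS eqS subrr.
rewrite dotBr; move: (tx); rewrite inE => /eqP ->; apply: z => // s _.
by rewrite subr_ge0.
Qed.

(** Walking from [x] along [u] stays on the walls through [x] until the first
    new wall is hit; [step t] is the time at which wall [t] is reached. *)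
Lemma advance_to_wall x u :
  polyhedron x -> (forall t, t \in tight x -> dot (g t) u = 0) ->
  (exists t, dot (g t) u < 0) ->
  exists2 x', polyhedron x' & tight x \proper tight x'.
Proof.
move=> Px ker [t0 neg0].
pose step t := (dot (g t) x - c t) / (- dot (g t) u).
case: (@arg_minP _ _ _ t0 (fun t => dot (g t) u < 0) step neg0) => t neg_t min_t.
have step_ge0 : 0 <= step t by apply: divr_ge0; [rewrite subr_ge0; apply: Px | lra].
have hit : dot (g t) (x + step t *: u) = c t.
  by rewrite dotDr dotZr /step; field; lra.
exists (x + step t *: u) => [s|].
  have [neg_s|pos_s] := ltP (dot (g s) u) 0.
    have := min_t s neg_s; rewrite /(step s) ler_pdivlMr ?dotDr ?dotZr; lra.
  by rewrite dotDr dotZr; have := Px s; have := mulr_ge0 step_ge0 pos_s; lra.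
apply/properP; split.
  apply/fintype.subsetP => s sx; move: (sx); rewrite !inE dotDr dotZr => /eqP ->.
  by rewrite ker // mulr0 addr0.
exists t; first by rewrite inE hit.
by apply/negP => /ker; lra.
Qed.

(** A point of the face that lies on as many walls as possible is a vertex,
    since otherwise it could advance to a further wall; no compactness is
    involved.  The first hypothesis says that the recession cone is trivial. *)
Lemma vertex_in_face x :
  (forall u, (forall t, 0 <= dot (g t) u) -> u = 0) ->
  polyhedron x -> exists2 y, is_vertex polyhedron y & polyhedron y /\ tight x \subset tight y.
Proof.
move=> bounded.
have [w] := ubnP (#|~: tight x|); elim: w x => // w IHw x lt_w Px.
have [uniq|] := pselect (forall u, (forall t, t \in tight x -> dot (g t) u = 0) -> u = 0).
  by exists x => //; exact: vertex_of_tight.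
move=> /existsNP[u] /not_implyP[ker u0].
have [|x' Px' lt_xx'] := @advance_to_wall x u Px ker.
  apply: contrapT => none; apply/u0/bounded => t; rewrite leNgt; apply/negP => neg.
  by apply: none; exists t.
have [|y vy [Py sub]] := IHw x' _ Px'.
  by apply: (leq_trans (proper_card _) lt_w); rewrite properC.
by exists y => //; split=> //; apply: fintype.subset_trans sub; apply: proper_sub.
Qed.

Lemma open_walls x u (S : pred T) :
  (forall t, S t -> c t < dot (g t) x) ->
  exists2 e : R, 0 < e & forall t, S t -> c t < dot (g t) (x + e *: u).
Proof.
move=> lt_S; pose r t := `|dot (g t) u| / (dot (g t) x - c t).
have r_ge0 t : S t -> 0 <= r t.
  by move=> /lt_S lt; rewrite divr_ge0 // subr_ge0 ltW.
have sum_ge0 : 0 <= \sum_(t | S t) r t by apply: sumr_ge0.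
(* One step length for all walls: it is smaller than each [(r t)^-1], the
   length at which the wall [t] could be reached. *)
exists (1 + \sum_(t | S t) r t)^-1 => [|t St]; first by rewrite invr_gt0; lra.
have gap : 0 < dot (g t) x - c t by rewrite subr_gt0 lt_S.
have lt_r : r t < 1 + \sum_(t | S t) r t.
  by rewrite (bigD1 t) //= addrCA ltrDl ltr_pwDl // sumr_ge0 // => s /andP[/r_ge0].
rewrite dotDr dotZr.
suff: `|(1 + \sum_(t | S t) r t)^-1 * dot (g t) u| < dot (g t) x - c t.
  by rewrite ltr_norml; lra.
have pos : 0 < 1 + \sum_(t | S t) r t by lra.
by rewrite normrM gtr0_norm ?invr_gt0 // mulrC ltr_pdivrMr // mulrC -ltr_pdivrMr.
Qed.
End Polyhedron.

Section Facets.
Variables (R : realType) (d : nat).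

(** A convenient certificate: the set lies in [x0 + U] and contains a small
    step from [x0] in every direction of [U]. *)
Lemma affine_dimI (A : set 'rV[R]_d) x0 (U : {vspace 'rV[R]_d}) :
  A x0 -> (forall x, A x -> x - x0 \in U) ->
  (forall u, u \in U -> exists2 e : R, 0 < e & A (x0 + e *: u)) ->
  affine_dim A (\dim U).
Proof.
move=> Ax0 sub open; exists x0, U; split=> // W subW.
apply/subvP => u /open[e e0 /subW]; rewrite addrC addKr => eu.
by rewrite -(scalerK (lt0r_neq0 e0) u) memvZ.
Qed.

(** The point [x0] lies in the relative interior of the facet; moving it
    slightly along [g t0] gives an interior point of the polyhedron, so the
    dimensions are those of the whole space and of the kernel of [g t0]. *)
Lemma polyhedron_facet (T : finType) (g : T -> 'rV[R]_d) (c : T -> R) t0 x0 :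
  g t0 != 0 -> dot (g t0) x0 = c t0 -> (forall t, t != t0 -> c t < dot (g t) x0) ->
  is_facet (polyhedron g c) [set x | polyhedron g c x /\ dot (g t0) x = c t0].
Proof.
move=> g0 tight0 strict.
split; first by exists (g t0), (c t0); split=> // x; apply.
pose f : 'Hom('rV[R]_d, 'M[R]_1) := linfun (mulmxr (g t0)^T).
have fE u : (f u == 0) = (dot (g t0) u == 0).
  rewrite lfunE /= dotE; apply/eqP/eqP => [->|e]; first by rewrite mxE.
  by apply/matrixP => i j; rewrite !ord1 e mxE.
have dim_img : \dim (limg f) = 1%N.
  apply/eqP; rewrite eqn_leq; apply/andP; split.
    by apply: leq_trans (dimvS (subvf _)) _; rewrite dimvf.
  rewrite lt0n dimv_eq0; apply/eqP => img0.
  have: f (g t0) \in limg f by rewrite memv_img ?memvf.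
  by rewrite img0 memv0 fE gt_eqF // dot_self_gt0.
exists (\dim (lker f)); split.
  have -> : (\dim (lker f)).+1 = \dim (fullv : {vspace 'rV[R]_d}).
    by rewrite -(limg_ker_dim f fullv) capfv dim_img addn1.
  have [e e0 strict1] := open_walls (g t0) strict.
  have inner t : predT t -> c t < dot (g t) (x0 + e *: g t0).
    have [-> _|/strict1//] := eqVneq t t0.
    by rewrite dotDr dotZr tight0 ltrDl mulr_gt0 // dot_self_gt0.
  apply: (@affine_dimI _ (x0 + e *: g t0)) => [t|x _|u _]; rewrite ?memvf //.
    exact/ltW/inner.
  have [e' e'0 inner'] := open_walls u inner.
  by exists e' => // t; apply/ltW/inner'.
have P0 : polyhedron g c x0.
  by move=> t; have [->|/strict/ltW //] := eqVneq t t0; rewrite tight0.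
apply: (@affine_dimI _ x0) => [//|x [_ ex]|u].
  by rewrite memv_ker fE dotBr ex tight0 subrr.
rewrite memv_ker fE => /eqP u0.
have [e e0 strict1] := open_walls u strict.
exists e => //; split; last by rewrite dotDr dotZr u0 mulr0 addr0.
move=> t; have [->|/strict1/ltW //] := eqVneq t t0.
by rewrite dotDr dotZr u0 mulr0 addr0 tight0.
Qed.
End Facets.

(** * Parity and lattice bases *)

Lemma odd_sum_signs (d : nat) (f : 'I_d -> int) :
  (forall j, f j = 1 \/ f j = -1) -> exists e : int, \sum_j f j = d%:Z + 2 * e.
Proof.
move=> sgn; exists (- \sum_j (f j == -1)%:Z).
have -> : d%:Z = \sum_(j < d) 1 by rewrite sumr_const card_ord; lia.
rewrite mulrN mulr_sumr -sumrB; apply: eq_bigr => j _.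
by case: (sgn j) => ->.
Qed.

(** The greedy splitting of [z] into [k] parts of size at most [n]. *)
Lemma sum_truncated (n z k : nat) :
  (\sum_(l < k) minn n (z - l * n) = minn z (k * n))%N.
Proof. elim: k => [|k IH]; [rewrite big_ord0|rewrite big_ord_recr IH /=]; lia. Qed.

(** In the basis [B], the coordinates of [row p B - row q B] are [1] at [p] and [-1] at [q], which
    are not even unless [p = q]. *)
Lemma basis_rows_mod2 (r d : nat) (B : 'M[int]_(r, d)) (p q : 'I_r) :
  lattice_basis B -> (exists w, row p B - row q B = w *+ 2) -> p = q.
Proof.
move=> basis [w eq2]; apply/eqP/negP => /negP pq.
have [a [wE _]] := basis w.
have [x [_ uniq]] := basis (row p B - row q B).
have e1 : x = a *+ 2 by apply: uniq; rewrite eq2 wE !mulr2n mulmxDl.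
have e2 : x = delta_mx 0 p - delta_mx 0 q by apply: uniq; rewrite mulmxBl -!rowE.
have /rowP/(_ p) := etrans (esym e1) e2.
by rewrite !mxE !eqxx (negbTE pq) /=; lia.
Qed.

(** * Hadamard simplices *)

(** The rows of a Hadamard matrix normalised along a marked column that has
    been deleted.  Both the row and the column relations are kept: the row
    relations bound the simplex, the column ones give barycentric coordinates. *)
Record hadamard_rows (d : nat) (v : 'I_d.+1 -> 'rV[int]_d) : Prop := {
  row_sign : forall i j, v i 0 j = 1 \/ v i 0 j = -1;
  row_gram : forall i i', \sum_j v i 0 j * v i' 0 j = d.+1%:Z *+ (i == i') - 1;
  col_sum : forall j, \sum_i v i 0 j = 0;
  col_gram : forall j j', \sum_i v i 0 j * v i 0 j' = d.+1%:Z *+ (j == j') }.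

Lemma hadamard_vertexP (R : realType) (d : nat) (H : 'M[R]_d.+1) (c : 'I_d.+1) :
  hadamard_matrix H ->
  exists2 v : 'I_d.+1 -> 'rV[int]_d, hadamard_rows v &
    hadamard_vertex H c = fun i => map_mx intr (v i).
Proof.
move=> [sgn HHT].
have sq i j : H i j * H i j = 1 by case: (sgn i j) => ->; rewrite ?mulrNN mulr1.
have sgnM i j : H i c * H i j = 1 \/ H i c * H i j = -1.
  by case: (sgn i c) (sgn i j) => -> [] ->; rewrite ?mulrNN ?mulr1 ?mul1r; auto.
pose v i : 'rV[int]_d := \row_j (if H i c * H i (lift c j) == 1 then 1 else -1).
have vE i j : (v i 0 j)%:~R = H i c * H i (lift c j).
  rewrite mxE; case: eqP => [-> //|ne].
  by case: (sgnM i (lift c j)) => // ->.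
have gram i i' : \sum_j H i j * H i' j = d.+1%:R *+ (i == i').
  have /matrixP/(_ i i') := HHT; rewrite !mxE => <-.
  by apply: eq_bigr => j _; rewrite mxE.
have cgram j j' : \sum_i H i j * H i j' = d.+1%:R *+ (j == j').
  have NN : (d.+1%:R : R) != 0 by rewrite pnatr_eq0.
  have HTH : H^T *m H = d.+1%:R%:M.
    have : H *m (d.+1%:R^-1 *: H^T) = 1%:M.
      by rewrite -scalemxAr HHT -mul_scalar_mx -scalar_mxM mulVf.
    move=> /mulmx1C; rewrite -scalemxAl => e.
    by rewrite -(scalerKV NN (H^T *m H)) e -mul_scalar_mx mulmx1.
  have /matrixP/(_ j j') := HTH; rewrite !mxE => <-.
  by apply: eq_bigr => i _; rewrite mxE.
exists v; last first.
  by apply/funext => i; apply/rowP => j; rewrite [RHS]mxE vE mxE.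
split.
- by move=> i j; rewrite mxE; case: ifP => _; [left|right].
- move=> i i'; apply: (@intr_inj R).
  rewrite rmorph_sum rmorphB rmorphMn rmorph1 /=.
  have := gram i i'; rewrite (bigD1_ord c) //= => e.
  have {e}e : \sum_(j < d) H i (lift c j) * H i' (lift c j) =
      d.+1%:R *+ (i == i') - H i c * H i' c by rewrite -e addrAC subrr add0r.
  transitivity (H i c * H i' c * (d.+1%:R *+ (i == i') - H i c * H i' c)).
    rewrite -e mulr_sumr; apply: eq_bigr => j _; rewrite rmorphM /= !vE; ring.
  rewrite mulrBr mulrACA !sq mulr1; congr (_ - _).
  have [<-|_] := eqVneq i i'; last by rewrite !mulr0n mulr0.
  by rewrite sq mul1r.
- move=> j; apply: (@intr_inj R); rewrite rmorph_sum /=.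
  under eq_bigr do rewrite vE.
  by rewrite cgram (negbTE (neq_lift c j)) mulr0n.
- move=> j j'; apply: (@intr_inj R); rewrite rmorph_sum rmorphMn /=.
  rewrite (eq_bigr (fun i => H i (lift c j) * H i (lift c j'))) => [|i _].
    by rewrite cgram (inj_eq (@lift_inj _ c)).
  by rewrite rmorphM /= !vE mulrACA sq mul1r.
Qed.

Section TruncatedSimplex.
Variables (R : realType) (d : nat) (v : 'I_d.+1 -> 'rV[int]_d) (m n : nat).
Hypothesis v_rows : hadamard_rows v.
Hypothesis m_gt0 : (0 < m)%N.

Local Notation vR i := (map_mx intr (v i) : 'rV[R]_d).
Local Notation Q := (polytopeQ (convex_hull (fun i => vR i)) m n).

Lemma dot_intr (a b : 'rV[int]_d) :
  dot (map_mx intr a : 'rV[R]_d) (map_mx intr b) = (\sum_j a 0 j * b 0 j)%:~R.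
Proof. by rewrite rmorph_sum; apply: eq_bigr => j _; rewrite rmorphM /= !mxE. Qed.

Lemma dot_rows i i' : dot (vR i) (vR i') = d.+1%:R *+ (i == i') - 1.
Proof. by rewrite dot_intr (row_gram v_rows) rmorphB rmorphMn rmorph1. Qed.

(** The barycentric coordinates of [x] are [(1 + v_i . x) / (d + 1)]. *)
Lemma simplexE (x : 'rV[R]_d) :
  convex_hull (fun i => vR i) x <-> forall i, -1 <= dot (vR i) x.
Proof.
have N0 : (d.+1%:R : R) != 0 by rewrite pnatr_eq0.
split=> [[w [w0 w1 ->]] i|ge].
  rewrite dot_sumr (_ : -1 = \sum_l - w l); last by rewrite sumrN w1.
  apply: ler_sum => l _.
  rewrite dotZr dot_rows mulrBr mulr1 lerDr mulr_ge0 //.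
  by case: eqP => _; rewrite ?ler0n.
exists (fun i => d.+1%:R^-1 * (1 + dot (vR i) x)); split=> [i||].
- by rewrite mulr_ge0 ?invr_ge0 ?ler0n //; have := ge i; lra.
- rewrite -mulr_sumr big_split /= sumr_const card_ord -dot_suml.
  suff -> : \sum_i vR i = 0 by rewrite dotC -(scale0r 0) dotZr mul0r addr0 mulVf.
  apply/rowP => j; rewrite summxE mxE -[RHS](rmorph0 intr) -(col_sum v_rows j).
  by rewrite rmorph_sum; apply: eq_bigr => i _; rewrite mxE.
apply/rowP => j; rewrite summxE.
transitivity (d.+1%:R^-1 * \sum_i ((v i 0 j)%:~R + \sum_l x 0 l * (v i 0 l * v i 0 j)%:~R)); last first.
  rewrite mulr_sumr; apply: eq_bigr => i _; rewrite !mxE -mulrA mulrDl mul1r.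
  congr (_ * (_ + _)); rewrite mulr_suml; apply: eq_bigr => l _.
  by rewrite !mxE rmorphM /=; ring.
rewrite big_split /= -rmorph_sum (col_sum v_rows) add0r exchange_big /=.
rewrite (bigD1 j) //= [X in _ + X]big1 => [|l lj].
  by rewrite -mulr_sumr -rmorph_sum (col_gram v_rows) eqxx /= addr0 mulrCA mulVf ?mulr1.
by rewrite -mulr_sumr -rmorph_sum (col_gram v_rows) (negbTE lj) mulr0.
Qed.

(** The walls of [Q] in the integer chart: lower and upper sides of the cube,
    then the facets of the simplex. *)
Definition wall_normal (t : 'I_d + 'I_d + 'I_d.+1) : 'rV[int]_d :=
  match t with
  | inl (inl j) => delta_mx 0 j
  | inl (inr j) => - delta_mx 0 j
  | inr i => v i
  end.

Definition wall_offset (t : 'I_d + 'I_d + 'I_d.+1) : R :=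
  match t with
  | inl (inl _) => 0
  | inl (inr _) => - n%:R
  | inr i => 2^-1 * (n%:R * (\sum_j v i 0 j)%:~R - m%:R)
  end.

(** Twice the slack of a wall of [Q], expressed in the original coordinates
    of [P]. *)
Definition margin (x : 'rV[R]_d) (t : 'I_d + 'I_d + 'I_d.+1) : R :=
  match t with
  | inl (inl j) => n%:R + x 0 j
  | inl (inr j) => n%:R - x 0 j
  | inr i => m%:R + dot (vR i) x
  end.

Local Notation g t := (map_mx intr (wall_normal t) : 'rV[R]_d).

Lemma dot_delta j (y : 'rV[R]_d) : dot (map_mx intr (delta_mx 0 j)) y = y 0 j.
Proof.
rewrite /dot (bigD1 j) //= big1 => [|l lj]; rewrite !mxE ?eqxx ?(negbTE lj) /=.
  by rewrite mul1r addr0.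
by rewrite mul0r.
Qed.

Lemma dot_deltaN j (y : 'rV[R]_d) : dot (map_mx intr (- delta_mx 0 j)) y = - y 0 j.
Proof. by rewrite raddfN /= dotC -scaleN1r dotZr dotC dot_delta mulN1r. Qed.

Lemma dot_const i (a : R) : dot (vR i) (const_mx a) = a * (\sum_j v i 0 j)%:~R.
Proof. by rewrite rmorph_sum mulr_sumr; apply: eq_bigr => j _; rewrite !mxE mulrC. Qed.

Lemma dot_wall (x : 'rV[R]_d) t :
  dot (g t) (int_chart n x) = wall_offset t + 2^-1 * margin x t.
Proof.
case: t => [[j|j]|i] /=.
- by rewrite dot_delta !mxE; lra.
- by rewrite dot_deltaN !mxE; lra.
- by rewrite /int_chart dotZr dotDr dot_const; lra.
Qed.

Lemma polytopeQE : Q = polyhedron (fun t => g t) wall_offset.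
Proof.
have m0 : (0 : R) < m%:R by rewrite ltr0n.
have chart x : polyhedron (fun t => g t) wall_offset (int_chart n x) <->
    polytopeP (convex_hull (fun i => vR i)) m n x.
  split=> [Px|[[z /simplexE hz <-] cz] t].
    have ge t : 0 <= margin x t by have := Px t; rewrite /= dot_wall; lra.
    split; last by move=> j; move: (ge (inl (inl j))) (ge (inl (inr j))) => /=; lra.
    exists (m%:R^-1 *: x); last by rewrite scalerKV ?gt_eqF.
    apply/simplexE => i; rewrite dotZr mulrC ler_pdivlMr //.
    by have := ge (inr i); rewrite /=; lra.
  rewrite dot_wall lerDl; apply: mulr_ge0; first lra.
  case: t => [[j|j]|i]; rewrite /margin.
  - by have := cz j; lra.
  - by have := cz j; lra.
  - by rewrite dotZr; have := ler_wpM2l (ltW m0) (hz i); lra.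
apply/seteqP; split=> [_ [x Px <-]|y Qy]; first exact/chart.
have yE : int_chart n (2 *: y - const_mx n%:R) = y.
  by rewrite /int_chart subrK scalerK // pnatr_eq0.
by exists (2 *: y - const_mx n%:R) => //; apply/chart; rewrite yE.
Qed.


(** * Smoothness and the threshold *)

Lemma vertex_sign_sq i : dot (vR i) (vR i) = d%:R.
Proof. by rewrite dot_rows eqxx -natr1 addrK. Qed.

Lemma polyhedron_chart x : (forall t, 0 <= margin x t) ->
  polyhedron (fun t => g t) wall_offset (int_chart n x).
Proof. by move=> ge t; rewrite dot_wall; have := ge t; lra. Qed.

(** The point [- (m / d) v_i] is in the relative interior of the facet with
    normal [v_i]: it is inside the cube as [m < d n], and the other rows have
    value [m / d] on it. *)
Lemma row_normals_at i y : (m < d * n)%N ->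
  Q y -> dot (vR i) y = wall_offset (inr i) -> normals_at Q y (v i).
Proof.
rewrite polytopeQE => lt_mdn Qy tight_y.
have m0 : (0 : R) < m%:R by rewrite ltr0n.
have d_gt0 : (0 < d)%N by case: (d) lt_mdn.
have d0 : (0 : R) < d%:R by rewrite ltr0n.
have mn : m%:R < d%:R * n%:R :> R by rewrite -natrM ltr_nat.
exists [set x | polyhedron (fun t => g t) wall_offset x /\ dot (vR i) x = wall_offset (inr i)].
split=> //; last first.
  split; last by exists (wall_offset (inr i)); split=> // x; exact.
  rewrite /primitive_vec (bigD1 (Ordinal d_gt0)) //=.
  by case: (row_sign v_rows i (Ordinal d_gt0)) => ->; exact: gcd1n.
pose x0 := - (m%:R / d%:R) *: vR i.
have rd : (m%:R / d%:R) * d%:R = m%:R :> R by rewrite divfK ?gt_eqF.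
have rn : m%:R / d%:R < n%:R :> R by rewrite ltr_pdivrMr // mulrC.
have r0 : 0 < m%:R / d%:R :> R by rewrite divr_gt0.
apply: (@polyhedron_facet _ _ _ _ _ (inr i) (int_chart n x0)) => [||t ti].
- apply/eqP => /rowP/(_ (Ordinal d_gt0)); rewrite !mxE.
  by case: (row_sign v_rows i (Ordinal d_gt0)) => ->; rewrite /=; lra.
- rewrite dot_wall /margin /x0 dotZr vertex_sign_sq mulNr rd; lra.
- rewrite dot_wall ltrDl mulr_gt0 ?invr_gt0 ?ltr0n //.
  case: t ti => [[j|j]|l] ti; rewrite /margin /x0.
  + by rewrite !mxE; case: (row_sign v_rows i j) => ->; rewrite /=; lra.
  + by rewrite !mxE; case: (row_sign v_rows i j) => ->; rewrite /=; lra.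
  + have li : l != i by apply: contra ti => /eqP ->.
    by rewrite dotZr dot_rows (negbTE li) mulr0n; lra.
Qed.

Lemma box_direction0 (u : 'rV[R]_d) : (forall t, 0 <= dot (g t) u) -> u = 0.
Proof.
move=> ge; apply/rowP => j.
move: (ge (inl (inl j))) (ge (inl (inr j))) => /=.
by rewrite dot_deltaN dot_delta mxE; lra.
Qed.

(** The point [- r (v_i + v_i')] with [r = m / (d - 1)] lies on both facets, has
    value [2 r] on all other rows, and is in the cube because its coordinates
    are [0] or [2 r] up to sign. *)
Lemma vertex_on_two_rows i i' : i != i' -> (1 < d)%N ->
  m%:R <= (d%:R - 1) / 2 * n%:R :> R ->
  exists2 y, is_vertex Q y & [/\ Q y, dot (vR i) y = wall_offset (inr i) &
                                 dot (vR i') y = wall_offset (inr i')].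
Proof.
move=> ii' d_gt1 le_m; rewrite polytopeQE.
have d1 : (0 : R) < d%:R - 1 by rewrite subr_gt0 ltr1n.
have m0 : (0 : R) < m%:R by rewrite ltr0n.
pose r : R := m%:R / (d%:R - 1).
have rd : r * (d%:R - 1) = m%:R by rewrite divfK ?gt_eqF.
have r0 : 0 < r by rewrite divr_gt0.
have rn : 2 * r <= n%:R by rewrite mulrA ler_pdivrMr //; lra.
pose x := - r *: (vR i + vR i').
have dN : d.+1%:R = d%:R + 1 :> R by rewrite natr1.
have dot_x l : dot (vR l) x = - r * (d.+1%:R *+ (l == i) + d.+1%:R *+ (l == i') - 2).
  by rewrite dotZr dotDr !dot_rows; lra.
have i'i : i' == i = false by rewrite eq_sym (negbTE ii').
have [||y vy [Py /fintype.subsetP sub]] :=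
    @vertex_in_face _ _ _ (fun t => g t) wall_offset (int_chart n x).
- exact: box_direction0.
- apply: polyhedron_chart => -[[j|j]|l]; rewrite /margin.
  + by rewrite !mxE; case: (row_sign v_rows i j) (row_sign v_rows i' j) => -> [] ->; rewrite /=; lra.
  + by rewrite !mxE; case: (row_sign v_rows i j) (row_sign v_rows i' j) => -> [] ->; rewrite /=; lra.
  + rewrite dot_x dN; have [->|li] := eqVneq l i.
      by rewrite (negbTE ii') mulr0n mulr1n; lra.
    have [_|li'] := eqVneq l i'; rewrite ?mulr0n ?mulr1n; lra.
have tight_row l : l = i \/ l = i' -> dot (vR l) y = wall_offset (inr l).
  move=> hl; suff : inr l \in tight (fun t => g t) wall_offset y by rewrite inE => /eqP.
  apply: sub; rewrite inE dot_wall /margin dot_x dN; apply/eqP.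
  by case: hl => ->; rewrite ?eqxx ?i'i ?(negbTE ii') ?mulr0n ?mulr1n; lra.
exists y => //; split=> //; apply: tight_row; auto.
Qed.

Lemma smooth_threshold : (1 < d)%N -> (m < d * n)%N ->
  lattice_smooth (convex_hull (fun i => vR i)) m n ->
  (d%:R - 1) / 2 * n%:R < m%:R :> R.
Proof.
move=> d_gt1 lt_mdn [_ smooth]; rewrite ltNge; apply/negP => le_m.
have ne : (ord0 : 'I_d.+1) != ord_max by rewrite -val_eqE /=; lia.
have [y /smooth[r [B [basisB normalsB]]] [Qy tight0 tight1]] := vertex_on_two_rows ne d_gt1 le_m.
have := row_normals_at lt_mdn Qy tight0; rewrite normalsB => -[p _ pE].
have := row_normals_at lt_mdn Qy tight1; rewrite normalsB => -[q _ qE].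
have half : exists w, row p B - row q B = w *+ 2.
  (* Half the difference of two signs is [0] if they agree and the first one
     otherwise. *)
  rewrite pE qE; exists (\row_j (if v ord0 0 j == v ord_max 0 j then 0 else v ord0 0 j)).
  apply/rowP => j; rewrite mulr2n !mxE.
  by case: (row_sign v_rows ord0 j) (row_sign v_rows ord_max j) => -> [] ->.
have vv : v ord0 = v ord_max by rewrite -pE -qE (basis_rows_mod2 basisB half).
have := row_gram v_rows ord0 ord_max; rewrite -vv (row_gram v_rows) eqxx (negbTE ne); lia.
Qed.

(** * Normality above the threshold *)

Lemma int_rowP (x : 'rV[R]_d) : int_points R d x -> exists z : 'rV[int]_d, x = map_mx intr z.
Proof.
move=> int_x; exists (\row_j Num.floor (x 0 j)); apply/rowP => j; rewrite !mxE.
by apply/eqP; rewrite eq_sym -intrEfloor; apply: int_x.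
Qed.

Lemma int_points_map (z : 'rV[int]_d) : int_points R d (map_mx intr z).
Proof. by move=> j; rewrite mxE intr_int. Qed.

Lemma wall_offset_int (b : 'I_d.+1 -> int) i :
  (forall i, 2 * b i = n%:Z * (\sum_j v i 0 j) - m%:Z) ->
  wall_offset (inr i) = (b i)%:~R.
Proof.
move=> bE; rewrite /wall_offset.
have : (2 * b i)%:~R = (n%:Z * (\sum_j v i 0 j) - m%:Z)%:~R :> R by rewrite bE.
by rewrite intrB !intrM; lra.
Qed.

Lemma polytopeQ_intP (b : 'I_d.+1 -> int) (z : 'rV[int]_d) :
  (forall i, 2 * b i = n%:Z * (\sum_j v i 0 j) - m%:Z) ->
  Q (map_mx intr z) <-> in_box n%:Z z /\ forall i, 0 <= slack v b i z.
Proof.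
move=> bE; rewrite polytopeQE.
have low j : (0 <= (z 0 j)%:~R :> R) = (0 <= z 0 j) by rewrite ler0z.
have up j : ((z 0 j)%:~R <= n%:R :> R) = (z 0 j <= n%:Z).
  by rewrite -[n%:R]/(n%:Z%:~R) ler_int.
have row i : (wall_offset (inr i) <= dot (vR i) (map_mx intr z)) = (0 <= slack v b i z).
  by rewrite (wall_offset_int i bE) dot_intr ler_int subr_ge0.
split=> [Pz|[box ge] [[j|j]|i]].
- split=> [j|i]; last by rewrite -row; exact: (Pz (inr i)).
  rewrite -low -up; move: (Pz (inl (inl j))) (Pz (inl (inr j))) => /=.
  by rewrite dot_deltaN dot_delta mxE lerN2 => -> ->.
- by rewrite /= dot_delta mxE low; case/andP: (box j).
- by rewrite /= dot_deltaN lerN2 mxE up; case/andP: (box j).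
- by rewrite /= [leLHS](_ : _ = wall_offset (inr i)) // row.
Qed.

(** In the coordinates [2 y - n] of the cube, [v_i + v_i'] is at least
    [- n] times its 1-norm, and this norm is [d + v_i . v_i' = d - 1]. *)
Lemma threshold_slack_pair (b : 'I_d.+1 -> int) i i' z :
  (forall i, 2 * b i = n%:Z * (\sum_j v i 0 j) - m%:Z) ->
  (d%:Z - 1) * n%:Z < 2 * m%:Z ->
  i != i' -> in_box n%:Z z -> 0 < slack v b i z + slack v b i' z.
Proof.
move=> bE lt ii' box.
have -> : slack v b i z + slack v b i' z =
    \sum_j (v i 0 j + v i' 0 j) * z 0 j - (b i + b i').
  rewrite /slack addrACA -opprD -big_split; congr (_ - _).
  by apply: eq_bigr => j _; rewrite mulrDl.
suff: - n%:Z * (d%:Z - 1) <= \sum_j (v i 0 j + v i' 0 j) * (2 * z 0 j - n%:Z).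
  rewrite (eq_bigr (fun j => 2 * ((v i 0 j + v i' 0 j) * z 0 j) - n%:Z * (v i 0 j + v i' 0 j))).
    rewrite sumrB -!mulr_sumr big_split /=.
    by have := bE i; have := bE i'; lra.
  by move=> j _; ring.
have -> : d%:Z - 1 = \sum_j (1 + v i 0 j * v i' 0 j).
  by rewrite big_split /= (row_gram v_rows) (negbTE ii') mulr0n sumr_const card_ord; lia.
rewrite mulr_sumr; apply: ler_sum => j _; have := box j.
by case: (row_sign v_rows i j) (row_sign v_rows i' j) => -> [] ->; lia.
Qed.

(** Two sign vectors with product [-1] force [d] to be odd; then every
    [n (sum_j v_ij)] is odd like [m]. *)
Lemma int_offsets : (1 < d)%N -> odd m -> odd n ->
  exists b : 'I_d.+1 -> int, forall i, 2 * b i = n%:Z * (\sum_j v i 0 j) - m%:Z.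
Proof.
move=> d_gt1 odd_m odd_n.
have [|p pE] := @odd_sum_signs d (fun j => v ord0 0 j * v ord_max 0 j).
  by move=> j; case: (row_sign v_rows ord0 j) (row_sign v_rows ord_max j) => -> [] ->; auto.
have ne : (ord0 : 'I_d.+1) != ord_max by rewrite -val_eqE /=; lia.
have odd_d : d%:Z = 2 * (- p - 1) + 1.
  by move: pE; rewrite (row_gram v_rows) (negbTE ne); lia.
suff /choice[b hb] : forall i, exists b : int, 2 * b = n%:Z * (\sum_j v i 0 j) - m%:Z by exists b.
move=> i; have [e ->] := odd_sum_signs (row_sign v_rows i).
have nE : n%:Z = 2 * n./2%:Z + 1 by have := odd_double_half n; rewrite odd_n; lia.
have mE : m%:Z = 2 * m./2%:Z + 1 by have := odd_double_half m; rewrite odd_m; lia.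
exists (n%:Z * (e - p - 1) + n./2%:Z - m./2%:Z).
by rewrite odd_d nE mE; ring.
Qed.

Lemma box_decomposition (k : nat) (z : 'rV[int]_d) :
  (forall j, 0 <= z 0 j <= k%:Z * n%:Z) ->
  exists y : 'I_k -> 'rV[int]_d, (forall l, in_box n%:Z (y l)) /\ \sum_l y l = z.
Proof.
move=> box_z.
exists (fun l => \row_j (minn n (`|z 0 j| - l * n))%:Z); split=> [l j|].
  by rewrite mxE; lia.
apply/rowP => j; rewrite summxE; under eq_bigr do rewrite mxE.
rewrite -(big_morph Posz PoszD (erefl _)) sum_truncated.
have /andP[z_ge0 z_le] := box_z j.
by rewrite (minn_idPl _) ?gez0_abs // -lez_nat gez0_abs.
Qed.

Lemma threshold_normal : (1 < d)%N -> odd m -> odd n ->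
  (d%:R - 1) / 2 * n%:R < m%:R :> R -> lattice_normal Q.
Proof.
move=> d_gt1 odd_m odd_n lt_m k k_gt0 _ [[q Qq <-] /int_rowP[z zE]].
have [b bE] := int_offsets d_gt1 odd_m odd_n.
have k0 : (0 : R) <= k%:R by rewrite ler0n.
have lt_int : (d%:Z - 1) * n%:Z < 2 * m%:Z.
  rewrite -(ltr_int R) !intrM intrB; lra.
have Pq t : wall_offset t <= dot (g t) q by move: Qq t; rewrite polytopeQE.
have z_dot (a : 'rV[int]_d) : (\sum_j a 0 j * z 0 j)%:~R = k%:R * dot (map_mx intr a) q.
  by rewrite -dot_intr -zE dotZr.
have [j|y [box_y sum_y]] := @box_decomposition k z.
  have zj : (z 0 j)%:~R = k%:R * q 0 j.
    by move/rowP/(_ j): zE; rewrite !mxE => <-.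
  move: (Pq (inl (inl j))) (Pq (inl (inr j))) => /=.
  rewrite dot_deltaN dot_delta lerN2 => q0 qn.
  rewrite -(ler0z R) -(ler_int R _ (k%:Z * n%:Z)) intrM zj.
  by rewrite mulr_ge0 // ler_wpM2l.
have [||||y' [box_y' slack_y' sum_y']] := @repair _ _ v b n%:Z _ _ _ y.
- exact: row_sign.
- by move=> i i' w; exact: threshold_slack_pair.
- exact: box_y.
- move=> i; rewrite slack_sum sum_y -(ler0z R) intrB z_dot intrM -(wall_offset_int i bE).
  by rewrite -mulrBr mulr_ge0 // subr_ge0; exact: (Pq (inr i)).
exists (fun l => map_mx intr (y' l)); split=> [l|].
  by split; [apply/(polytopeQ_intP (y' l) bE) | exact: int_points_map].
by rewrite zE -sum_y -sum_y' raddf_sum.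
Qed.

End TruncatedSimplex.

Unset Implicit Arguments.
Set Strict Implicit.

Theorem corollary3p2 (R : realType) (d : nat) (Delta : set 'rV[R]_d)
  (m n : nat) (hDelta : hadamard_simplex Delta)
  (m_odd : odd m) (n_odd : odd n) (lt_nm : (n < m)%N) (lt_mdn : (m < d * n)%N) :
  ((d%:R - 1) / 2 * n%:R < m%:R :> R -> lattice_normal (polytopeQ Delta m n))
  /\ (lattice_smooth Delta m n -> lattice_normal (polytopeQ Delta m n)).
Proof.
have [H [c [hH ->]]] := hDelta; have [v v_rows ->] := hadamard_vertexP c hH.
have m_gt0 : (0 < m)%N by apply: leq_trans lt_nm.
have d_gt1 : (1 < d)%N by case: (d) lt_mdn => [|[|//]]; lia.
have normal := @threshold_normal R d v m n v_rows m_gt0 d_gt1 m_odd n_odd.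
split=> [//|smooth]; apply: normal.
exact: smooth_threshold smooth.
Qed.
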